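(* Let $G$ be a finite abelian group, let $S_{init} \subset G$ have bias $\epsilon_0$, let $\Gamma$ be a regular undirected graph with vertex set $S_{init}$ and $\lambda(\Gamma)=\lambda$ (with $\Gamma$ also denoting its random walk matrix), let $\chi$ be a nontrivial character of $G$ and $\Pi = \Pi(\chi)$. Then (i) $\|\Pi\| = 1$; (ii) $\|(\Pi\Gamma)^2\| \le \epsilon_0 + 2\lambda$. Consequently, for every integer $t \ge 1$, $\|(\Pi\Gamma)^t \Pi\| \le (\epsilon_0 + 2\lambda)^{\lfloor t/2 \rfloor}$.
   Context: A character of a finite abelian group $G$ is a homomorphism $\chi: G\to\mathbb{C}^*$; it is nontrivial if not identically $1$. The bias of a set $S \subseteq G$ is $\max_{\chi \text{ nontrivial}} |\mathbb{E}_{x \in S}[\chi(x)]|$ (uniform $x$). $\lambda(\Gamma)$ is the second largest absolute value of an eigenvalue of the random walk (normalized adjacency) matrix of $\Gamma$. $\Pi(\chi)$ is the diagonal matrix on $\mathbb{C}^{S_{init}}$ with $\Pi(\chi)e_x = \chi(x) e_x$. $\|\cdot\|$ is the operator ($\ell_2$) norm. *)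

(* Defs.v *)
From HB Require Import structures.
From mathcomp Require Import all_boot all_order all_algebra all_fingroup.
From mathcomp Require Import mathcomp_extra boolp classical_sets reals.
From mathcomp Require Import complex.
Set Implicit Arguments.
Unset Strict Implicit.
Unset Printing Implicit Defensive.
Import Order.TTheory GRing.Theory Num.Theory.
Local Open Scope ring_scope.
Local Open Scope complex_scope.
Local Open Scope classical_set_scope.

(* [Normc.normc z : R] is the modulus of [z : R[i]]; the generic [`|z|] lives
   in [R[i]]. *)

Definition l2norm (R : realType) n (v : 'cV[R[i]]_n) : R :=
  Num.sqrt (\sum_(i < n) Normc.normc (v i 0) ^+ 2).

Definition opnorm (R : realType) n (A : 'M[R[i]]_n) : R :=
  sup [set l2norm (A *m v) | v in [set v : 'cV[R[i]]_n | l2norm v <= 1]].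

(* The finite abelian group is written additively, C^* multiplicatively. *)
Definition is_character (R : realType) (G : finZmodType) (chi : G -> R[i]) : Prop :=
  (forall x, chi x != 0) /\ (forall x y, chi (x + y) = chi x * chi y).

Definition nontrivial (R : realType) (G : finZmodType) (chi : G -> R[i]) : Prop :=
  exists x, chi x != 1.

Definition expectation (R : realType) (G : finZmodType) (S : {set G})
  (f : G -> R[i]) : R[i] := (\sum_(x in S) f x) / #|S|%:R.

(* There are finitely many characters, so the supremum is a maximum whenever a
   nontrivial character exists. *)
Definition bias (R : realType) (G : finZmodType) (S : {set G}) : R :=
  sup [set Normc.normc (expectation S chi) |
        chi in [set chi : G -> R[i] | is_character chi /\ nontrivial chi]].

(* Undirected graph, with loops and parallel edges allowed: [mult x y] is the
   number of edges between [x] and [y].  A simple graph is the case where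
   [mult] is 0/1-valued with zero diagonal.  The degree is positive, as
   otherwise there is no random walk. *)
Record regular_graph (V : finType) := RegularGraph {
  mult : V -> V -> nat;
  degree : nat;
  mult_sym : forall x y, mult x y = mult y x;
  degree_gt0 : (0 < degree)%N;
  mult_regular : forall x, (\sum_y mult x y)%N = degree }.

Definition walk_mx (R : realType) (V : finType) (g : regular_graph V) :
    'M[R[i]]_#|V| :=
  \matrix_(i, j) ((mult g (enum_val i) (enum_val j))%:R / (degree g)%:R).

(* Eigenvalues listed with algebraic multiplicity. *)
Definition eigenvalues (R : realType) n (A : 'M[R[i]]_n) : seq R[i] :=
  sval (closed_field_poly_normal (char_poly A)).

(* The second entry of the decreasing list of the |eigenvalues|, counted with
   multiplicity; 0 by convention for a graph with a single vertex. *)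
Definition lambda (R : realType) (V : finType) (g : regular_graph V) : R :=
  nth 0 (sort >=%R [seq Normc.normc z | z <- eigenvalues (walk_mx R g)]) 1.

(* Coordinates of C^S are indexed by the enumeration of [{x : G | x \in S}], the
   same as in [walk_mx]. *)
Definition char_mx (R : realType) (G : finZmodType) (S : {set G})
    (chi : G -> R[i]) : 'M[R[i]]_#|{: {x : G | x \in S}}| :=
  diag_mx (\row_i chi (val (enum_val i))).

(* Main.v *)
(* On mean-zero vectors W shrinks the norm by lambda (spectral theorem), so
   W = J + E with J the averaging projection and |E| <= lambda.  Expanding
   W P W = J P J + E P J + W P E, the first term is the mean of chi times J,
   hence of norm at most eps0, and the other two have norm at most lambda. *)
Require Import Defs.
From HB Require Import structures.
From mathcomp Require Import all_boot all_order all_algebra all_fingroup.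
From mathcomp Require Import mathcomp_extra boolp classical_sets reals.
From mathcomp Require Import complex.
From mathcomp Require Import ring.
Set Implicit Arguments.
Unset Strict Implicit.
Unset Printing Implicit Defensive.
Import Order.TTheory GRing.Theory Num.Theory.
Local Open Scope ring_scope.
Local Open Scope complex_scope.

Local Notation normc := Normc.normc.
Local Notation "A ^t*" := (A ^t Num.conj)%sesqui (at level 30) : ring_scope.

(** * Norms of vectors and matrices *)

Section L2Norm.
Variable R : realType.
Local Notation C := R[i].

Lemma normc_norm (z : C) : (normc z)%:C = `|z|.
Proof. by []. Qed.

Lemma normc_ge0 (z : C) : 0 <= normc z.
Proof. by case: z => a b; exact: sqrtr_ge0. Qed.

Lemma normcX (z : C) k : normc (z ^+ k) = normc z ^+ k.
Proof.
by elim: k => [|k IHk]; rewrite ?expr0 ?Normc.normc1// !exprS Normc.normcM IHk.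
Qed.

Lemma normc_real (a : R) : 0 <= a -> normc a%:C = a.
Proof. by move=> a0; rewrite /= expr0n addr0 sqrtr_sqr ger0_norm. Qed.

Lemma normc_eq1 (z : C) k : (0 < k)%N -> z ^+ k = 1 -> normc z = 1.
Proof.
move=> k0 /(congr1 (@normc R)); rewrite normcX Normc.normc1 => /eqP.
by rewrite pexprn_eq1 ?normc_ge0// eqn0Ngt k0 => /eqP.
Qed.

Lemma le_normc_sum (I : finType) (F : I -> C) (P : pred I) :
  normc (\sum_(i | P i) F i) <= \sum_(i | P i) normc (F i).
Proof.
apply: (big_ind2 (fun x y => normc x <= y)) => [|x1 y1 x2 y2 le1 le2|//].
  by rewrite Normc.normc0.
exact: le_trans (le_normcD x1 x2) (lerD le1 le2).
Qed.

Lemma l2norm_ge0 n (v : 'cV[C]_n) : 0 <= l2norm v.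
Proof. exact: sqrtr_ge0. Qed.

Lemma sqr_l2norm n (v : 'cV[C]_n) :
  l2norm v ^+ 2 = \sum_(i < n) normc (v i 0) ^+ 2.
Proof. by rewrite sqr_sqrtr// sumr_ge0// => i _; rewrite sqr_ge0. Qed.

(** Links the real-valued norm to the Hermitian product, where adjoints and unitarity can be
    exploited. *)
Lemma sqr_l2norm_dot n (v : 'cV[C]_n) :
  (l2norm v ^+ 2)%:C = (v ^t* *m v) 0 0.
Proof.
rewrite sqr_l2norm rmorph_sum mxE; apply: eq_bigr => i _.
by rewrite !mxE rmorphXn/= normc_norm normCK mulrC.
Qed.

Lemma l2norm_le n (v w : 'cV[C]_n) (c : R) :
  0 <= c -> l2norm v ^+ 2 <= c ^+ 2 * l2norm w ^+ 2 -> l2norm v <= c * l2norm w.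
Proof.
by move=> c0; rewrite -exprMn ler_pXn2r// nnegrE ?mulr_ge0 ?l2norm_ge0.
Qed.

Lemma l2norm0 n : l2norm (0 : 'cV[C]_n) = 0.
Proof.
apply/eqP; rewrite -sqrf_eq0 sqr_l2norm big1// => i _.
by rewrite mxE Normc.normc0 expr0n.
Qed.

Lemma l2norm_eq0 n (v : 'cV[C]_n) : l2norm v = 0 -> v = 0.
Proof.
move=> v0; apply/matrixP => i j; rewrite ord1 mxE; apply: Normc.eq0_normc.
have /eqP := sqr_l2norm v; rewrite v0 expr0n/= eq_sym psumr_eq0; last first.
  by move=> k _; rewrite sqr_ge0.
by move=> /allP/(_ i (mem_index_enum _)); rewrite sqrf_eq0 => /eqP.
Qed.

Lemma l2normZ n (a : C) (v : 'cV[C]_n) : l2norm (a *: v) = normc a * l2norm v.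
Proof.
apply/eqP; rewrite -(@eqrXn2 _ 2) ?mulr_ge0 ?l2norm_ge0 ?normc_ge0//.
rewrite exprMn !sqr_l2norm mulr_sumr; apply/eqP/eq_bigr => i _.
by rewrite mxE Normc.normcM exprMn.
Qed.

Lemma l2normD n (v w : 'cV[C]_n) : l2norm (v + w) <= l2norm v + l2norm w.
Proof.
have [/l2norm_eq0->|v0] := eqVneq (l2norm v) 0.
  by rewrite l2norm0 !add0r.
have [/l2norm_eq0->|w0] := eqVneq (l2norm w) 0.
  by rewrite l2norm0 !addr0.
set a := l2norm v in v0 *; set b := l2norm w in w0 *.
have a_gt0 : 0 < a by rewrite lt_def v0 l2norm_ge0.
have b_gt0 : 0 < b by rewrite lt_def w0 l2norm_ge0.
rewrite -(@ler_pXn2r _ 2) ?nnegrE ?addr_ge0 ?l2norm_ge0//.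
(* Convexity of the square with weights a/(a+b) and b/(a+b). Applied entrywise and summed, it gives
   exactly (a+b)^2, in place of Cauchy-Schwarz; the zero cases were split off because of the
   divisions. *)
have convex (x y : R) :
    (x + y) ^+ 2 <= (a + b) / a * x ^+ 2 + (a + b) / b * y ^+ 2.
  rewrite -subr_ge0.
  have -> : (a + b) / a * x ^+ 2 + (a + b) / b * y ^+ 2 - (x + y) ^+ 2
          = (b * x - a * y) ^+ 2 / (a * b).
    by field; rewrite v0 w0.
  by rewrite divr_ge0 ?sqr_ge0 ?mulr_ge0 ?ltW.
apply: (@le_trans _ _ ((a + b) / a * a ^+ 2 + (a + b) / b * b ^+ 2)); last first.
  by rewrite le_eqVlt; apply/orP; left; apply/eqP; field; rewrite v0 w0.
rewrite !sqr_l2norm !mulr_sumr -big_split/=; apply: ler_sum => i _.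
apply: le_trans (convex _ _); rewrite ler_pXn2r ?nnegrE ?addr_ge0 ?normc_ge0//.
by rewrite mxE; exact: le_normcD.
Qed.

Lemma opnorm_le n (A : 'M[C]_n) (c : R) : 0 <= c ->
  (forall v, l2norm (A *m v) <= c * l2norm v) -> opnorm A <= c.
Proof.
move=> c0 Ac; apply: ge_sup.
  by exists (l2norm (A *m 0)), 0; rewrite //= l2norm0.
by move=> _ [v /= v1 <-]; apply: le_trans (Ac v) _; rewrite ler_piMr.
Qed.

Lemma opnorm_isometry n (A : 'M[C]_n) : (0 < n)%N ->
  (forall v, l2norm (A *m v) = l2norm v) -> opnorm A = 1.
Proof.
case: n A => // n A _ Aiso; apply/eqP; rewrite eq_le opnorm_le//=; last first.
  by move=> v; rewrite Aiso mul1r.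
(* A unit vector attains the supremum. In dimension 0 there is none, and the operator norm would be
   0. *)
pose e : 'cV[C]_n.+1 := delta_mx 0 0.
have e1 : l2norm e = 1.
  apply/eqP; rewrite -(@eqrXn2 _ 2) ?l2norm_ge0// sqr_l2norm expr1n.
  rewrite (bigD1 ord0)//= mxE Normc.normc1 expr1n big1 ?addr0// => i /negPf i0.
  by rewrite mxE i0 Normc.normc0 expr0n.
apply: ub_le_sup; last by exists e; rewrite /= ?Aiso e1.
by exists 1 => _ [v /= v1 <-]; rewrite Aiso.
Qed.

Lemma l2norm_exprmx n (A : 'M[C]_n) (c : R) k : 0 <= c ->
  (forall v, l2norm (A *m v) <= c * l2norm v) ->
  forall v, l2norm (A ^+ k *m v) <= c ^+ k * l2norm v.
Proof.
move=> c0 Ac; elim: k => [|k IHk] v; first by rewrite mul1mx mul1r.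
rewrite exprSr exprSr -mulrA -mulmxA; apply: le_trans (IHk _) _.
by rewrite ler_wpM2l ?exprn_ge0.
Qed.

Lemma l2norm_unitary n (Q : 'M[C]_n) (v : 'cV[C]_n) :
  Q \is unitarymx -> l2norm (Q *m v) = l2norm v.
Proof.
move=> Qu; apply/eqP; rewrite -(@eqrXn2 _ 2) ?l2norm_ge0//; apply/eqP.
apply: (@complexI R); rewrite !sqr_l2norm_dot trmx_mul map_mxM -mulmxA.
by rewrite -invmx_unitary// mulKmx// unitarymx_unit.
Qed.

End L2Norm.

(** * Contraction and spectral gap of symmetric stochastic matrices *)

Section SymmetricStochastic.
Variable R : realType.
Local Notation C := R[i].

(** Jensen's inequality in each row, whose entries are probability weights; after summing over the
    rows and exchanging the sums, the column sums 1 finish. *)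
Lemma stochastic_contraction n (a : 'M[R]_n) (v : 'cV[C]_n) :
  (forall i j, 0 <= a i j) -> (forall i, \sum_j a i j = 1) ->
  (forall j, \sum_i a i j = 1) ->
  l2norm (map_mx (real_complex R) a *m v) <= l2norm v.
Proof.
move=> a_ge0 a_row a_col; rewrite -(@ler_pXn2r _ 2) ?nnegrE ?l2norm_ge0//.
rewrite !sqr_l2norm.
have jensen i : normc ((map_mx (real_complex R) a *m v) i 0) ^+ 2 <=
    \sum_j a i j * normc (v j 0) ^+ 2.
  set m := \sum_j a i j * normc (v j 0).
  apply: (@le_trans _ _ (m ^+ 2)).
    rewrite ler_pXn2r ?nnegrE ?normc_ge0 ?sumr_ge0//; last first.
      by move=> j _; rewrite mulr_ge0 ?normc_ge0.
    rewrite mxE; apply: le_trans (le_normc_sum _ _) _; apply: ler_sum => j _.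
    by rewrite mxE Normc.normcM normc_real.
  (* Jensen for the square amounts to nonnegativity of this variance. *)
  have : 0 <= \sum_j a i j * (normc (v j 0) - m) ^+ 2.
    by apply: sumr_ge0 => j _; rewrite mulr_ge0 ?sqr_ge0.
  suff -> : \sum_j a i j * (normc (v j 0) - m) ^+ 2
          = \sum_j a i j * normc (v j 0) ^+ 2 - m ^+ 2 by rewrite subr_ge0.
  transitivity (\sum_j a i j * normc (v j 0) ^+ 2 - m * 2 * m + m ^+ 2 * 1).
    have -> : m * 2 * m = \sum_j m * 2 * (a i j * normc (v j 0)).
      by rewrite -mulr_sumr.
    rewrite -[X in m ^+ 2 * X](a_row i) mulr_sumr -sumrB -big_split/=.
    by apply: eq_bigr => j _; ring.
  by ring.
apply: le_trans (ler_sum _ (fun i _ => jensen i)) _.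
rewrite exchange_big/=; apply: ler_sum => j _.
by rewrite -mulr_suml a_col mul1r.
Qed.

Lemma char_poly_diagonalized n (Q : 'M[C]_n) (d : 'rV[C]_n) :
  Q \in unitmx -> char_poly (invmx Q *m diag_mx d *m Q) =
    \prod_(z <- [seq d 0 i | i <- enum 'I_n]) ('X - z%:P).
Proof.
move=> Qu; rewrite big_map big_enum/=.
have := char_poly_trig (diag_mx_is_trig d).
rewrite (eq_bigr (fun i => 'X - (d 0 i)%:P)); last by move=> i _; rewrite mxE eqxx.
move=> <-; rewrite /char_poly.
have -> : char_poly_mx (invmx Q *m diag_mx d *m Q) =
    map_mx polyC (invmx Q) *m char_poly_mx (diag_mx d) *m map_mx polyC Q.
  rewrite /char_poly_mx mulmxBr mulmxBl -!map_mxM; congr (_ - _).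
  by rewrite -mulmxA -scalar_mxC mulmxA -map_mxM mulVmx// map_mx1 mul1mx.
rewrite !det_mulmx mulrAC -det_mulmx -map_mxM mulVmx// map_mx1 det1.
by rewrite mul1r.
Qed.

(** In a decreasing list the entries that are at least c form a prefix. *)
Lemma nth_sorted_ge (s : seq R) (c : R) k : sorted >=%R s ->
  (k < count (>= c) s)%N -> c <= nth 0 s k.
Proof.
elim: s k => [|x s IHs] [|k] //= xs.
  case: leP => //= xc; rewrite add0n -has_count => /hasP[y ys cy].
  have /allP/(_ y ys) := order_path_min (rev_trans le_trans) xs.
  by move=> /(le_trans cy); rewrite leNgt xc.
have s_sorted := path_sorted xs; case: leP => /= xc.
  by rewrite add1n ltnS; exact: IHs.
by rewrite add0n => /ltnW; exact: IHs.
Qed.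

(** Distinct indices count as two eigenvalues with multiplicity, even when the entries of [d] there
    coincide. *)
Lemma second_norm_ge n (A : 'M[C]_n) (d : 'rV[C]_n) (i j : 'I_n) (c : R) :
  char_poly A = \prod_(z <- [seq d 0 k | k <- enum 'I_n]) ('X - z%:P) ->
  i != j -> c <= normc (d 0 i) -> c <= normc (d 0 j) ->
  c <= nth 0 (sort >=%R [seq normc z | z <- eigenvalues A]) 1.
Proof.
move=> charA ij ci cj; apply: nth_sorted_ge.
  by apply: sort_sorted => x y; exact: le_total.
rewrite (seq.permP (permEl (perm_sort _ _))) count_map.
(* A split polynomial determines its roots up to order, so the chosen list [eigenvalues A] is a
   rearrangement of [d]. *)
have /seq.permP -> : perm_eq (eigenvalues A) [seq d 0 k | k <- enum 'I_n].
  apply: prod_XsubC_eq; rewrite -charA /eigenvalues.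
  case: closed_field_poly_normal => s /= {1}->.
  by rewrite (monicP (char_poly_monic A)) scale1r.
rewrite count_map -size_filter.
apply: (@uniq_leq_size _ [:: i; j]); first by rewrite /= inE ij.
by move=> k; rewrite !inE mem_filter mem_enum/= andbT => /orP[]/eqP->.
Qed.

(* If 1 <= lambda the contraction bound suffices; otherwise 1 is a simple
   eigenvalue whose eigenline is spanned by the constant vector, and all the
   other eigenvalues are bounded by lambda. *)
Lemma l2norm_spectral_gap n (a : 'M[R]_n) (v : 'cV[C]_n)
    (A := map_mx (real_complex R) a)
    (lam := nth 0 (sort >=%R [seq normc z | z <- eigenvalues A]) 1) :
  (0 < n)%N -> 0 <= lam ->
  (forall i j, 0 <= a i j) -> (forall i, \sum_j a i j = 1) ->
  (forall i j, a i j = a j i) ->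
  \sum_i v i 0 = 0 -> l2norm (A *m v) <= lam * l2norm v.
Proof.
move=> n_gt0 lam0 a_ge0 a_row a_sym sum_v.
have [lam1|lam1] := leP 1 lam.
  apply: le_trans (stochastic_contraction _ a_ge0 a_row _) _.
    by move=> j; rewrite -(a_row j); apply: eq_bigr => i _.
  by rewrite ler_peMl ?l2norm_ge0.
have : A \is normalmx.
  apply: hermitian_normalmx; apply: realsym_hermsym.
    apply/is_hermitianmxP; rewrite expr0 scale1r.
    by apply/matrixP => i j; rewrite !mxE a_sym.
  by apply/mxOverP => i j; rewrite mxE; apply: ger0_real; rewrite lecR.
move=> /orthomx_spectralP.
set Q := spectralmx A; set d := spectral_diag A => AE.
have Qu : Q \is unitarymx := spectral_unitarymx A.
have QU := unitarymx_unit Qu.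
have charA := char_poly_diagonalized d QU; rewrite -AE in charA.
have QA (w : 'cV[C]_n) i : (Q *m (A *m w)) i 0 = d 0 i * (Q *m w) i 0.
  by rewrite {1}AE -!mulmxA mulKVmx// mul_diag_mx mxE.
pose u : 'cV[C]_n := const_mx 1.
have Au : A *m u = u.
  apply/matrixP => i j; rewrite !mxE -[RHS](rmorph1 (real_complex R)) -(a_row i).
  by rewrite rmorph_sum/=; apply: eq_bigr => k _; rewrite !mxE mulr1.
have Qu_neq0 : Q *m u != 0.
  apply/eqP => /(congr1 (mulmx (invmx Q))); rewrite mulKmx// mulmx0.
  by move=> /matrixP/(_ (Ordinal n_gt0) 0)/eqP; rewrite !mxE oner_eq0.
have [i0 i0P] : exists i0, (Q *m u) i0 0 != 0.
  apply/existsP; apply: contraNT Qu_neq0; rewrite negb_exists => /forallP z.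
  apply/eqP/matrixP => i j; rewrite ord1 [RHS]mxE; apply/eqP.
  by have := z i; rewrite negbK.
have d_i0 i : (Q *m u) i 0 != 0 -> d 0 i = 1.
  by move=> Qui; apply: (mulIf Qui); rewrite -QA Au mul1r.
have d_small i : i != i0 -> normc (d 0 i) <= lam.
  move=> ii0; rewrite leNgt; apply/negP => lam_lt.
  (* The entries at [i] and [i0] both reach this threshold, since [d 0 i0] is 1, so the second
     modulus would too; yet both arguments of the minimum exceed [lam]. *)
  suff : Num.min (normc (d 0 i)) 1 <= lam by rewrite leNgt lt_min lam_lt lam1.
  apply: (second_norm_ge charA ii0); rewrite ge_min ?lexx//.
  by rewrite (d_i0 i0)// Normc.normc1 lexx orbT.
(* A second nonzero coordinate would be a second eigenvalue 1 > [lam]. *)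
have Qu0 i : i != i0 -> (Q *m u) i 0 = 0.
  move=> ii0; apply/eqP; apply: contraT => /d_i0 d1.
  by have := d_small _ ii0; rewrite d1 Normc.normc1 leNgt lam1.
(* Unitarity preserves the product of [u] and [v], which is the sum of [v], hence 0; only its term
   at [i0] survives in the eigenbasis. *)
have Qv0 : (Q *m v) i0 0 = 0.
  have : ((Q *m u) ^t* *m (Q *m v)) 0 0 = 0.
    rewrite trmx_mul map_mxM -mulmxA -invmx_unitary// mulKmx// mxE -[RHS]sum_v.
    by apply: eq_bigr => i _; rewrite !mxE rmorph1 mul1r.
  rewrite mxE (bigD1 i0)//= big1; last first.
    by move=> i /Qu0; rewrite !mxE => ->; rewrite rmorph0 mul0r.
  rewrite addr0 2!mxE => /eqP; rewrite mulf_eq0 fmorph_eq0 (negPf i0P).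
  by move=> /eqP.
apply: l2norm_le => //; rewrite -(l2norm_unitary _ Qu) -(l2norm_unitary v Qu).
rewrite !sqr_l2norm mulr_sumr; apply: ler_sum => i _.
rewrite QA Normc.normcM exprMn; have [->|ii0] := eqVneq i i0.
  by rewrite Qv0 Normc.normc0 expr0n !mulr0.
rewrite ler_wpM2r ?sqr_ge0// ler_pXn2r ?nnegrE ?normc_ge0//.
exact: d_small.
Qed.

End SymmetricStochastic.

(** * The averaging projection and two steps of the twisted walk *)

Section BiasedWalk.
Variable R : realType.
Local Notation C := R[i].

(** The orthogonal projection onto constant vectors, written as the image of a real matrix so that
    [stochastic_contraction] applies. *)
Definition avg_mx n : 'M[C]_n := map_mx (real_complex R) (const_mx n%:R^-1).

Lemma avg_mxE n (v : 'cV[C]_n) i : (avg_mx n *m v) i 0 = (\sum_j v j 0) / n%:R.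
Proof.
rewrite mxE mulr_suml; apply: eq_bigr => j _.
by rewrite !mxE fmorphV rmorph_nat mulrC.
Qed.

Lemma sum_const_inv n : (0 < n)%N -> \sum_(i < n) (n%:R^-1 : R) = 1.
Proof.
by move=> n0; rewrite sumr_const card_ord -[LHS]mulr_natl divff ?pnatr_eq0 -?lt0n.
Qed.

Lemma l2norm_avg n (v : 'cV[C]_n) : (0 < n)%N ->
  l2norm (avg_mx n *m v) <= l2norm v.
Proof.
move=> n0; have sum1 := sum_const_inv n0.
apply: stochastic_contraction => [i j|i|i]; first by rewrite mxE invr_ge0.
  by rewrite -{}[RHS]sum1; apply: eq_bigr => j _; rewrite mxE.
by rewrite -{}[RHS]sum1; apply: eq_bigr => j _; rewrite mxE.
Qed.

Lemma sum_sub_avg n (v : 'cV[C]_n) : (0 < n)%N ->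
  \sum_i (v - avg_mx n *m v) i 0 = 0.
Proof.
move=> n0; under eq_bigr do rewrite 2!mxE [X in - X]avg_mxE.
rewrite sumrB sumr_const card_ord -[X in _ - X]mulr_natr divfK ?subrr//.
by rewrite pnatr_eq0 -lt0n.
Qed.

(* J is an orthogonal projection, so |v - Jv|^2 = |v|^2 - |Jv|^2. *)
Lemma l2norm_sub_avg n (v : 'cV[C]_n) : (0 < n)%N ->
  l2norm (v - avg_mx n *m v) <= l2norm v.
Proof.
move=> n0; set J := avg_mx n.
have Jherm : J ^t* = J.
  apply/matrixP => i j; rewrite !mxE.
  by apply/CrealP/ger0_real; rewrite lecR invr_ge0.
have JJ (w : 'cV[C]_n) : J *m (J *m w) = J *m w.
  apply/matrixP => i j; rewrite ord1 !avg_mxE; congr (_ / _).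
  under eq_bigr do rewrite avg_mxE.
  by rewrite sumr_const card_ord -[LHS]mulr_natr divfK// pnatr_eq0 -lt0n.
suff: l2norm (v - J *m v) ^+ 2 + l2norm (J *m v) ^+ 2 = l2norm v ^+ 2.
  move=> eq_norm; rewrite -(@ler_pXn2r _ 2) ?nnegrE ?l2norm_ge0//.
  by rewrite -eq_norm lerDl sqr_ge0.
apply: (@complexI R); rewrite rmorphD/= !sqr_l2norm_dot.
have -> : (v - J *m v) ^t* = v ^t* - v ^t* *m J.
  by rewrite linearB/= map_mxB trmx_mul map_mxM/= Jherm.
rewrite trmx_mul map_mxM/= Jherm mulmxBl !mulmxBr -!mulmxA JJ.
by rewrite subrr subr0 [X in X + _]mxE [X in _ + X + _]mxE addrNK.
Qed.

(** The analytic core, free of groups: characters enter only through the isometry of the diagonal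
    matrix and the mean of its entries. *)
Lemma l2norm_diag_walk_sqr n (a : 'M[R]_n) (d : 'rV[C]_n) (eps : R)
    (A := map_mx (real_complex R) a)
    (lam := nth 0 (sort >=%R [seq normc z | z <- eigenvalues A]) 1) :
  (0 < n)%N -> 0 <= lam ->
  (forall i j, 0 <= a i j) -> (forall i, \sum_j a i j = 1) ->
  (forall i j, a i j = a j i) ->
  (forall v : 'cV[C]_n, l2norm (diag_mx d *m v) = l2norm v) ->
  normc ((\sum_i d 0 i) / n%:R) <= eps ->
  forall v, l2norm ((diag_mx d *m A) ^+ 2 *m v) <= (eps + 2 * lam) * l2norm v.
Proof.
move=> n0 lam0 a_ge0 a_row a_sym Piso d_eps v; set P := diag_mx d.
set J := avg_mx n.
have Acontr (w : 'cV[C]_n) : l2norm (A *m w) <= l2norm w.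
  apply: stochastic_contraction => // j.
  by rewrite -(a_row j); apply: eq_bigr => i _.
have AJ (w : 'cV[C]_n) : A *m (J *m w) = J *m w.
  apply/matrixP => i j; rewrite ord1 mxE.
  under eq_bigr do rewrite avg_mxE mxE.
  by rewrite -mulr_suml -rmorph_sum/= a_row mul1r avg_mxE.
(* As A J = J, the difference is A applied to the mean-zero vector w - J w, which is no longer than
   w. *)
have Egap (w : 'cV[C]_n) : l2norm (A *m w - J *m w) <= lam * l2norm w.
  rewrite -(AJ w) -mulmxBr.
  have mean0 := sum_sub_avg w n0.
  apply: le_trans (l2norm_spectral_gap n0 lam0 a_ge0 a_row a_sym mean0) _.
  by rewrite ler_wpM2l// l2norm_sub_avg.
(* J v is constant, so averaging P J v just multiplies that constant by the mean of [d]. *)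
have JPJ : J *m (P *m (J *m v)) = ((\sum_i d 0 i) / n%:R) *: (J *m v).
  apply/matrixP => i j; rewrite ord1 avg_mxE [RHS]mxE.
  under eq_bigr do rewrite mul_diag_mx mxE avg_mxE.
  by rewrite -mulr_suml avg_mxE mulrAC.
have -> : (P *m A) ^+ 2 *m v = P *m (J *m (P *m (J *m v)) +
    (A *m (P *m (J *m v)) - J *m (P *m (J *m v))) +
    A *m (P *m (A *m v - J *m v))).
  rewrite expr2 -!mulmxE -!mulmxA; congr (_ *m _).
  by rewrite !mulmxBr [X in X + _]addrC addrNK [RHS]addrC addrNK.
rewrite Piso; apply: le_trans (l2normD _ _) _.
have -> : (eps + 2 * lam) * l2norm v =
    eps * l2norm v + lam * l2norm v + lam * l2norm v by ring.
apply: lerD; last by apply: le_trans (Acontr _) _; rewrite Piso.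
apply: le_trans (l2normD _ _) _; apply: lerD.
  rewrite JPJ l2normZ; apply: ler_pM; rewrite ?normc_ge0 ?l2norm_ge0//.
  exact: l2norm_avg.
apply: le_trans (Egap _) _.
by rewrite Piso ler_wpM2l// l2norm_avg.
Qed.

End BiasedWalk.

(** * Characters, bias and the final bounds *)

Lemma character_normc (R : realType) (G : finZmodType) (chi : G -> R[i]) x :
  is_character chi -> normc (chi x) = 1.
Proof.
move=> [chi_neq0 chiD].
have chi0 : chi 0 = 1 by apply: (mulfI (chi_neq0 0)); rewrite -chiD addr0 mulr1.
have chiMn k : chi (x *+ k) = chi x ^+ k.
  by elim: k => [|k IHk]; rewrite ?mulr0n// mulrS chiD exprS IHk.
(* The value [chi x] is a root of unity, as the order of [x] kills [x]. *)
apply: (@normc_eq1 _ _ #[x]%g); rewrite ?order_gt0//.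
by rewrite -chiMn -FinRing.zmodXgE expg_order.
Qed.

Lemma normc_expectation_le_bias (R : realType) (G : finZmodType) (S : {set G})
    (chi : G -> R[i]) :
  is_character chi -> nontrivial chi ->
  normc (expectation S chi) <= bias R S.
Proof.
move=> chiP chi_nt; apply: ub_le_sup; last by exists chi.
(* A supremum dominates its set only when the set is bounded above; 1 is a bound because character
   values have modulus 1. *)
exists 1 => _ [psi [/= psiP _] <-].
rewrite Normc.normcM Normc.normcV.
have -> : normc (#|S|%:R : R[i]) = #|S|%:R.
  by rewrite -(rmorph_nat (real_complex R)) normc_real.
have [->|S_gt0] := posnP #|S|; first by rewrite invr0 mulr0.
rewrite ler_pdivrMr ?ltr0n// mul1r; apply: le_trans (le_normc_sum _ _) _.
under eq_bigr do rewrite character_normc//.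
by rewrite sumr_const.
Qed.

Lemma big_enum_type (T : Type) (idx : T) (op : Monoid.com_law idx)
    (V : finType) (F : V -> T) :
  \big[op/idx]_(i < #|V|) F (enum_val i) = \big[op/idx]_x F x.
Proof. by rewrite [RHS](reindex _ (onW_bij _ (enum_val_bij _))). Qed.

(** Puts the walk matrix in the form, image of a real matrix, that the spectral lemmas expect. *)
Lemma walk_mxE (R : realType) (V : finType) (g : regular_graph V) :
  walk_mx R g = map_mx (real_complex R) (\matrix_(i, j)
    ((mult g (enum_val i) (enum_val j))%:R / (degree g)%:R)).
Proof. by apply/matrixP => i j; rewrite !mxE fmorph_div !rmorph_nat. Qed.

Theorem theorem3p2 (R : realType) (G : finZmodType) (Sinit : {set G})
    (eps0 lam : R) (Gam : regular_graph {x : G | x \in Sinit})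
    (chi : G -> R[i]) :
  Sinit != finset.set0 ->
  bias R Sinit = eps0 ->
  lambda R Gam = lam ->
  is_character chi ->
  nontrivial chi ->
  let P := char_mx Sinit chi in
  let W := walk_mx R Gam in
  [/\ opnorm P = 1,
      opnorm ((P *m W) ^+ 2) <= eps0 + 2 * lam
    & forall t : nat, (1 <= t)%N ->
        opnorm ((P *m W) ^+ t *m P) <= (eps0 + 2 * lam) ^+ (t %/ 2)].
Proof.
move=> S_neq0 biasE lamE chiP chi_nt P W.
set n := #|{: {x : G | x \in Sinit}}| in P W *.
have nE : n = #|Sinit| by rewrite /n card_sig; apply: eq_card => x; rewrite !inE.
have n_gt0 : (0 < n)%N by rewrite nE card_gt0.
have Piso (v : 'cV[R[i]]_n) : l2norm (P *m v) = l2norm v.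
  apply/eqP; rewrite -(@eqrXn2 _ 2) ?l2norm_ge0// !sqr_l2norm; apply/eqP.
  apply: eq_bigr => i _.
  by rewrite mul_diag_mx !mxE Normc.normcM character_normc// mul1r.
have mean_chi : normc ((\sum_(i < n) chi (val (enum_val i))) / n%:R) <= eps0.
  rewrite (big_enum_type _ (fun x => chi (val x))) nE -biasE.
  have -> : \sum_(x : {x : G | x \in Sinit}) chi (val x) = \sum_(x in Sinit) chi x.
    by rewrite -(big_sub _ (fun x => chi x)).
  exact: normc_expectation_le_bias.
have lam_ge0 : 0 <= lam.
  rewrite -lamE /lambda.
  set s := sort _ _.
  (* The second entry is either a modulus or, for a single vertex, the default 0. *)
  have [s1|/(nth_default 0)->//] := ltnP 1 (size s).
  have := mem_nth 0 s1; rewrite mem_sort => /mapP[z _ ->].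
  exact: normc_ge0.
have eps_ge0 : 0 <= eps0 by apply: le_trans mean_chi; exact: normc_ge0.
have c_ge0 : 0 <= eps0 + 2 * lam by rewrite addr_ge0 ?mulr_ge0.
pose a : 'M[R]_n :=
  \matrix_(i, j) ((mult Gam (enum_val i) (enum_val j))%:R / (degree Gam)%:R).
have WE : W = map_mx (real_complex R) a := walk_mxE R Gam.
have a_ge0 i j : 0 <= a i j by rewrite mxE divr_ge0.
have a_sym i j : a i j = a j i by rewrite !mxE mult_sym.
have a_row i : \sum_j a i j = 1.
  under eq_bigr do rewrite mxE.
  rewrite -mulr_suml -natr_sum.
  by rewrite (big_enum_type _ (mult Gam (enum_val i))) mult_regular divff// pnatr_eq0 -lt0n degree_gt0.
have Wcontr (v : 'cV[R[i]]_n) : l2norm (W *m v) <= l2norm v.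
  rewrite WE; apply: stochastic_contraction => // j.
  by rewrite -(a_row j); apply: eq_bigr => i _.
have PW2 v : l2norm ((P *m W) ^+ 2 *m v) <= (eps0 + 2 * lam) * l2norm v.
  rewrite -lamE /lambda -/W WE; apply: l2norm_diag_walk_sqr => //.
    by move: lam_ge0; rewrite -lamE /lambda -/W WE.
  by under eq_bigr do rewrite mxE.
split; [exact: opnorm_isometry|exact: opnorm_le|move=> t _].
apply: opnorm_le => [|v]; first by rewrite exprn_ge0.
(* The trailing P is absorbed by replacing v with the equally long P v. *)
rewrite -[l2norm v]Piso -mulmxA; set w := P *m v.
(* Factors P W are grouped in pairs, each costing [eps0 + 2 * lam]; the leftover factor for odd t is
   a contraction and costs 1. *)
rewrite {1}(divn_eq t 2) exprD mulnC exprM -mulmxE -mulmxA.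
apply: le_trans (l2norm_exprmx _ c_ge0 PW2 _) _.
rewrite ler_wpM2l ?exprn_ge0// -[leRHS]mul1r -(expr1n R (t %% 2)).
apply: l2norm_exprmx => // x; rewrite mul1r -mulmxA Piso; exact: Wcontr.
Qed.
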